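(* For every $n\ge 1$, $|\mathcal{DRS}_n(132,213)|=F_{n+1}$.
   Context: For $\sigma\in\mathfrak{S}_n$, a double descent is an index $i$ with $\sigma_i>\sigma_{i+1}>\sigma_{i+2}$. The permutation $\sigma$ is simsun if for every $k$, the subword of $\sigma$ consisting of the letters in $\{1,\dots,k\}$ (in the order they appear in $\sigma$) has no double descent. For $\omega\in\mathfrak{S}_t$, $\sigma$ contains an $\omega$-pattern if there are indices $i_1<\cdots<i_t$ with $\sigma_{i_j}<\sigma_{i_k}$ iff $\omega_j<\omega_k$; otherwise $\sigma$ avoids $\omega$. $\mathcal{DRS}_n(132,213)$ is the set of $\sigma\in\mathfrak{S}_n$ that avoid both $132$ and $213$, are simsun, and whose inverse $\sigma^{-1}$ is simsun. $F_n$ is the Fibonacci number with $F_1=F_2=1$, $F_{n}=F_{n-1}+F_{n-2}$. *)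

(* Defs.v *)
From mathcomp Require Import all_boot all_fingroup.

Set Implicit Arguments.
Unset Strict Implicit.
Unset Printing Implicit Defensive.

(* Positions and letters are numbered from 0: the letter written j in {1..n}
   is the ordinal of value j - 1. *)

Definition word (n : nat) (s : 'S_n) : seq nat :=
  [seq nat_of_ord (s i) | i <- enum 'I_n].

Definition double_descent (w : seq nat) (i : nat) : bool :=
  [&& i.+2 < size w, nth 0 w i > nth 0 w i.+1 & nth 0 w i.+1 > nth 0 w i.+2].

(* The letters {1..k} are the ordinals of value < k. *)
Definition subword (n : nat) (s : 'S_n) (k : nat) : seq nat :=
  [seq a <- word s | a < k].

Definition no_double_descent (w : seq nat) : bool :=
  [forall i : 'I_(size w), ~~ double_descent w i].

(* Letters are < n, so values k > n would add nothing. *)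
Definition simsun (n : nat) (s : 'S_n) : bool :=
  [forall k : 'I_n.+1, no_double_descent (subword s k)].

Definition contains (t n : nat) (w : 'S_t) (s : 'S_n) : bool :=
  [exists f : {ffun 'I_t -> 'I_n},
    [forall j : 'I_t, forall k : 'I_t, (j < k) ==> (f j < f k)] &&
    [forall j : 'I_t, forall k : 'I_t, (s (f j) < s (f k)) == (w j < w k)]].

Definition avoids (t n : nat) (w : 'S_t) (s : 'S_n) : bool := ~~ contains w s.

(* 132 exchanges the last two positions, 213 the first two. *)
Definition p132 : 'S_3 := tperm (inord 1) (inord 2).
Definition p213 : 'S_3 := tperm (inord 0) (inord 1).

Definition DRS (n : nat) (P : {set 'S_3}) : {set 'S_n} :=
  [set s : 'S_n | [&& [forall w in P, avoids w s], simsun s & simsun s^-1%g]].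

Fixpoint fib (n : nat) : nat :=
  if n is m.+1 then (if m is l.+1 then fib m + fib l else 1) else 0.

(* Main.v *)
(* A permutation avoiding 132 and 213 is a sequence of increasing runs, each run
   lying entirely below the previous one; hence it is determined by its descent
   word in {0,1}^(n-1), and every such word occurs. For these permutations, any
   decreasing triple with nothing strictly inside it (in position and value)
   comes from two consecutive descents, so simsun, simsun inverse, and absence
   of double descents are all the same condition. The binary words of length
   n-1 without two consecutive ones are counted by F_{n+1}. *)

Require Import Defs.
From mathcomp Require Import all_boot all_fingroup.
From mathcomp Require Import zify.

Set Implicit Arguments.
Unset Strict Implicit.
Unset Printing Implicit Defensive.

(** * Pattern avoidance in inequalities, and permutations determined by order *)

Section Avoidance.

Variable n : nat.
Implicit Types (s t : 'S_n) (x y z : 'I_n).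

(** The first conjunct excludes 132, the second 213: two comparisons already fix each of these
    patterns. *)
Definition avoids_both s :=
  forall x y z, x < y -> y < z ->
    ~ (s x < s z /\ s z < s y) /\ ~ (s y < s x /\ s x < s z).

Lemma contains_triple (w : 'S_3) s :
  contains w s <->
  exists x y z, [/\ x < y, y < z,
    (s x < s y) = (w (inord 0) < w (inord 1)),
    (s y < s z) = (w (inord 1) < w (inord 2)) &
    (s x < s z) = (w (inord 0) < w (inord 2))].
Proof.
split.
  move=> /existsP[f /andP[/forallP fI /forallP fP]].
  have fi (j k : 'I_3) : j < k -> f j < f k.
    by move=> jk; have /forallP/(_ k)/implyP := fI j; apply.
  have fw (j k : 'I_3) : (s (f j) < s (f k)) = (w j < w k).
    by have /forallP/(_ k)/eqP := fP j.
  exists (f (inord 0)), (f (inord 1)), (f (inord 2)).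
  by split; rewrite ?fw //; apply: fi; rewrite !inordK.
move=> [x [y [z [xy yz e1 e2 e3]]]].
pose f : {ffun 'I_3 -> 'I_n} :=
  [ffun j : 'I_3 => if val j is j'.+1 then if j' is _.+1 then z else y else x].
have neq (i j : 'I_n) : i < j -> s i != s j :> nat.
  by move=> ij; rewrite val_eqE (inj_eq perm_inj) -val_eqE /= neq_ltn ij.
have wneq (i j : 'I_3) : i < j -> w i != w j :> nat.
  by move=> ij; rewrite val_eqE (inj_eq perm_inj) -val_eqE /= neq_ltn ij.
have := (neq _ _ xy, neq _ _ yz, neq _ _ (ltn_trans xy yz)) => -[[n1 n2] n3].
have m1 := @wneq (inord 0) (inord 1); have m2 := @wneq (inord 1) (inord 2).
have m3 := @wneq (inord 0) (inord 2).
rewrite !inordK // in m1 m2 m3.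
have {}m1 := m1 isT; have {}m2 := m2 isT; have {}m3 := m3 isT.
have ord3 (j : 'I_3) : [\/ j = inord 0, j = inord 1 | j = inord 2].
  by case: j => [[|[|[|//]]] jP]; [apply: Or31|apply: Or32|apply: Or33];
    apply: val_inj; rewrite /= inordK.
apply/existsP; exists f; apply/andP; split; apply/forallP => j;
  apply/forallP => k; case: (ord3 j) => ->; case: (ord3 k) => ->;
  rewrite !ffunE /= !inordK //=; lia.
Qed.

Lemma avoids_bothP s :
  reflect (avoids_both s) [forall w in [set p132; p213], avoids w s].
Proof.
have i012 : ((inord 0 == inord 1 :> 'I_3) = false) *
            ((inord 0 == inord 2 :> 'I_3) = false) *
            ((inord 1 == inord 0 :> 'I_3) = false) *
            ((inord 1 == inord 2 :> 'I_3) = false) *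
            ((inord 2 == inord 0 :> 'I_3) = false) *
            ((inord 2 == inord 1 :> 'I_3) = false).
  by do !split; rewrite -val_eqE /= !inordK.
apply: (iffP forallP) => [av x y z xy yz|av w].
  have xz := ltn_trans xy yz.
  have nc w : w \in [set p132; p213] -> ~ contains w s.
    by move=> ww; have /implyP/(_ ww)/negP := av w.
  split=> -[h1 h2].
    apply: (nc p132); rewrite ?set21 //; apply/contains_triple.
    by exists x, y, z; rewrite /p132 !permE /= !eqxx !i012 !inordK //; split=> //; lia.
  apply: (nc p213); rewrite ?set22 //; apply/contains_triple.
  by exists x, y, z; rewrite /p213 !permE /= !eqxx !i012 !inordK //; split=> //; lia.
apply/implyP => /set2P ww; apply/negP => /contains_triple[x [y [z [xy yz]]]].
have [h1 h2] := av _ _ _ xy yz.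
have neq (i j : 'I_n) : i < j -> s i != s j :> nat.
  by move=> ij; rewrite val_eqE (inj_eq perm_inj) -val_eqE /= neq_ltn ij.
have := neq _ _ xy; have := neq _ _ yz.
by case: ww => ->; rewrite /p132 /p213 !permE /= !eqxx !i012 !inordK //; lia.
Qed.

(** Both patterns are involutions, so exchanging positions and values preserves each of them. *)
Lemma avoids_bothV s : avoids_both s -> avoids_both s^-1%g.
Proof.
move=> av x y z xy yz; split=> -[h1 h2].
  have := av _ _ _ h1 h2; rewrite !permKV; lia.
have := av _ _ _ h1 h2; rewrite !permKV; lia.
Qed.

Lemma perm_order_rank s x : s x = #|[set y | s y < s x]| :> nat.
Proof.
have -> : [set y | s y < s x] = s @^-1: [set z : 'I_n | z < s x].
  by apply/setP => y; rewrite !inE.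
rewrite card_preimset; last exact: perm_inj.
by rewrite -sum1dep_card -(big_ord_widen n (fun=> 1)) ?sum1_card ?card_ord // ltnW.
Qed.

Lemma perm_order_inj s t :
  (forall x y, x < y -> (s x < s y) = (t x < t y)) -> s = t.
Proof.
move=> st.
have e x y : (s y < s x) = (t y < t x).
  case: (ltngtP x y) => [xy|yx|/val_inj->]; [|exact: st|by rewrite !ltnn].
  have sxy : s x != s y :> nat by rewrite val_eqE (inj_eq perm_inj) -val_eqE /= neq_ltn xy.
  have txy : t x != t y :> nat by rewrite val_eqE (inj_eq perm_inj) -val_eqE /= neq_ltn xy.
  have := st _ _ xy; lia.
apply/permP => x; apply: val_inj; rewrite /= [LHS]perm_order_rank [RHS]perm_order_rank.
by apply: eq_card => y; rewrite !inE e.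
Qed.

(** Standardization: each key is replaced by its rank, the number of smaller keys. *)
Lemma exists_perm_order (k : 'I_n -> nat) :
  injective k -> exists s, forall x y, (s x < s y) = (k x < k y).
Proof.
move=> k_inj.
have rP x : #|[set y | k y < k x]| < n.
  rewrite -[X in _ < X]card_ord -cardsT; apply: proper_card.
  rewrite properE subsetT; apply/subsetPn; exists x; rewrite ?inE //.
  by rewrite ltnn.
pose r x := Ordinal (rP x).
have rlt x y : k x < k y -> r x < r y.
  move=> xy; apply: proper_card; rewrite properE; apply/andP; split.
    by apply/subsetP => z; rewrite !inE => /ltn_trans; apply.
  by apply/subsetPn; exists x; rewrite !inE ?ltnn.
have r_inj : injective r.
  move=> x y exy; apply: k_inj.
  by case: (ltngtP (k x) (k y)) => // /rlt; rewrite exy ltnn.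
exists (perm r_inj) => x y; rewrite !permE.
case: (ltngtP (k x) (k y)) => [/rlt|/rlt|/k_inj->]; rewrite ?ltnn //; lia.
Qed.

End Avoidance.

(** * Descent words of avoiding permutations *)

Section DescentWord.

Variable m : nat.
Implicit Types (s t : 'S_m.+1) (x y z : 'I_m.+1) (w : bitseq).

Definition descent_word s : bitseq :=
  mkseq (fun i => s (inord i.+1) < s (inord i)) m.

Definition sparse w := sorted (fun a b => ~~ (a && b)) w.

(** The index of the increasing run containing position [i], that is, the number of descents before
    it. *)
Definition block w i := count id (take i w).

Lemma blockS w i : i < size w -> block w i.+1 = block w i + nth false w i.
Proof.
by move=> iw; rewrite /block (take_nth false iw) -cats1 count_cat /= addn0.
Qed.

Lemma block_leq w i j : i <= j -> block w i <= block w j.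
Proof.
move=> ij; rewrite /block -(subnKC ij) takeD count_cat; exact: leq_addr.
Qed.

Lemma block_leq_size w i : block w i <= size w.
Proof. by apply: leq_trans (count_size _ _) _; rewrite size_take_min geq_minr. Qed.

Lemma sparseP w :
  reflect (forall i, i.+1 < size w -> ~~ (nth false w i && nth false w i.+1))
          (sparse w).
Proof.
case: w => [|a w] /=; first by apply: (iffP idP).
by apply: (iffP (pathP false)).
Qed.

Lemma nth_descent_word s i :
  i < m -> nth false (descent_word s) i = (s (inord i.+1) < s (inord i)).
Proof. by move=> im; rewrite nth_mkseq. Qed.

Lemma size_descent_word s : size (descent_word s) = m.
Proof. exact: size_mkseq. Qed.

Lemma val_perm_neq s x y : x != y :> nat -> s x != s y :> nat.
Proof. by rewrite !val_eqE (inj_eq perm_inj). Qed.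

(** Induction on [j]. If the step from [j] to [j.+1] is an ascent, avoiding 213 keeps a larger
    letter at [i] above both; if it is a descent, avoiding 132 puts the new letter below the one at
    [i]. *)
Lemma perm_ltn_block s i j :
  avoids_both s -> i < j -> j <= m ->
  (s (inord i) < s (inord j)) =
    (block (descent_word s) i == block (descent_word s) j).
Proof.
move=> av; elim: j => // j IHj; rewrite ltnS => ij jm.
rewrite blockS ?size_descent_word // nth_descent_word //.
have jj : s (inord j) != s (inord j.+1) :> nat.
  by apply: val_perm_neq; rewrite !inordK //; lia.
move: ij; rewrite leq_eqVlt => /predU1P[->|ij]; first by lia.
have ii : s (inord i) != s (inord j.+1) :> nat.
  by apply: val_perm_neq; rewrite !inordK //; lia.
have ii' : s (inord i) != s (inord j) :> nat.
  by apply: val_perm_neq; rewrite !inordK //; lia.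
have := av (inord i) (inord j) (inord j.+1).
rewrite !inordK; try lia.
move=> /(_ ij (ltnSn j)).
have := IHj ij (ltnW jm); have := block_leq (descent_word s) (ltnW ij).
lia.
Qed.

Lemma descent_word_inj s t :
  avoids_both s -> avoids_both t -> descent_word s = descent_word t -> s = t.
Proof.
move=> avs avt est; apply: perm_order_inj => x y xy.
have ym : y <= m by rewrite -ltnS.
have := perm_ltn_block avs xy ym; have := perm_ltn_block avt xy ym.
by rewrite !inord_val est => -> ->.
Qed.

Lemma exists_descent_word w :
  size w = m -> exists2 s, avoids_both s & descent_word s = w.
Proof.
move=> wm.
(* Lexicographic: letters of later blocks are smaller, and letters increase
   within a block. *)
pose k x := (m - block w x) * m.+1 + x.
have kP x y : x < y -> (k x < k y) = (block w x == block w y).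
  move=> xy; rewrite /k.
  (* Blocks are at most [m], so the truncated subtraction is exact, and the weight [m.+1] exceeds
     every [x]. *)
  have := block_leq w (ltnW xy); have := block_leq_size w y; rewrite wm.
  have := ltn_ord y; nia.
have k_inj : injective k.
  move=> x y; rewrite /k => /(congr1 (modn^~ m.+1)).
  by rewrite !modnMDl !modn_small // => /val_inj.
have [s sP] := exists_perm_order k_inj.
have sb x y : x < y -> (s x < s y) = (block w x == block w y).
  by move=> xy; rewrite sP kP.
exists s.
  move=> x y z xy yz; have xz := ltn_trans xy yz.
  move: (sb _ _ xy) (sb _ _ yz) (sb _ _ xz).
  move: (block_leq w (ltnW xy)) (block_leq w (ltnW yz)); lia.
apply: (@eq_from_nth _ false) => [|i]; rewrite size_descent_word ?wm // => im.
rewrite nth_descent_word //.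
have := sb (inord i) (inord i.+1); rewrite !inordK; try lia.
move=> /(_ (ltnSn i)); rewrite blockS ?wm //.
have : s (inord i) != s (inord i.+1) :> nat.
  by apply: val_perm_neq; rewrite !inordK //; lia.
lia.
Qed.

(* The conclusion is invariant under [s |-> s^-1], so it rules out double
   descents both in subwords of [s] (positions) and in [s^-1] (values). *)
Lemma sparse_decreasing_triple s x y z :
  avoids_both s -> sparse (descent_word s) ->
  x < y -> y < z -> s y < s x -> s z < s y ->
  exists u, [/\ u != y, x < u < z & s z < s u < s x].
Proof.
move=> av /sparseP sp xy yz sxy syz.
have y0 : 0 < y by lia.
have zm : z <= m by rewrite -ltnS.
(* At least one of the steps into and out of [y] is an ascent; the neighbour of [y] across it will
   be the witness. *)
have := sp y.-1; rewrite size_descent_word !nth_descent_word ?prednK; try lia.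
rewrite inord_val.
move: (inord y.-1) (inord y.+1) (@inordK m y.-1) (@inordK m y.+1) => p q pE qE.
have {}pE : p = y.-1 :> nat by rewrite pE; lia.
have {}qE : q = y.+1 :> nat by rewrite qE; lia.
have sp_y : s p != s y :> nat by apply: val_perm_neq; lia.
have sq_y : s q != s y :> nat by apply: val_perm_neq; lia.
have xp : x != p :> nat -> s x != s p :> nat by exact: val_perm_neq.
have zp : s p != s z :> nat by apply: val_perm_neq; lia.
have xq : s x != s q :> nat by apply: val_perm_neq; lia.
(* Ascent into [y]: avoiding 132 at [p], [y], [z] gives [s z < s p]. Otherwise the ascent leaves
   [y], and avoiding 213 at [x], [y], [q] gives [s q < s x]. *)
have [spy _|spy] := ltnP (s p) (s y).
  have xNp : x != p :> nat by apply: contraTneq spy => /val_inj <-; rewrite -leqNgt ltnW.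
  exists p; have := av p y z; split; rewrite -?val_eqE /=; lia.
move=> h.
have yq : s y < s q by move: h; lia.
have qNz : q != z :> nat by apply: contraTneq yq => /val_inj ->; rewrite -leqNgt ltnW.
exists q; have := av x y q; split; rewrite -?val_eqE /=; lia.
Qed.

End DescentWord.

(** * Fibonacci enumeration of binary words without adjacent ones *)

Fixpoint sparse_words m : seq bitseq :=
  if m is m'.+1 then
    if m' is m''.+1 then
      map (cons false) (sparse_words m') ++
      map (cons true \o cons false) (sparse_words m'')
    else [:: [:: false]; [:: true]]
  else [:: [::]].

(** The recursion reaches back two lengths, so the induction carries two consecutive lengths at
    once. *)
Lemma size_sparse_words m : size (sparse_words m) = fib m.+2.
Proof.
have [] // : size (sparse_words m) = fib m.+2 /\
             size (sparse_words m.+1) = fib m.+3.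
elim: m => [|m [IH0 IH1]] //; split=> //.
by rewrite [LHS]size_cat !size_map IH1 IH0.
Qed.

Lemma uniq_sparse_words m : uniq (sparse_words m).
Proof.
have [] // : uniq (sparse_words m) /\ uniq (sparse_words m.+1).
elim: m => [|m [IH0 IH1]] //; split=> //.
rewrite [uniq _]cat_uniq !map_inj_uniq ?IH0 ?IH1 => [|? ? []|? ? []] //.
by rewrite andbT; apply/hasPn => _ /mapP[u _ ->]; apply/mapP => -[].
Qed.

Lemma mem_sparse_words m w :
  (w \in sparse_words m) = (size w == m) && sparse w.
Proof.
have [] // : (forall w, (w \in sparse_words m) = (size w == m) && sparse w) /\
  (forall w, (w \in sparse_words m.+1) = (size w == m.+1) && sparse w).
elim: m {w} => [|m [IH0 IH1]].
  by split; [case|case=> [|[] [|b w]]].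
split=> // w; rewrite [w \in _]mem_cat.
have consK b : injective (cons b : bitseq -> bitseq) by move=> ? ? [].
case: w => [|[] w].
- by apply/orP; case=> /mapP[].
- rewrite (_ : (_ \in map (cons false) _) = false); last by apply/mapP; case.
  rewrite map_comp (mem_map (consK _)) /=.
  case: w => [|[] w]; first by apply/mapP; case.
    by rewrite /sparse /= andbF; apply/mapP; case.
  rewrite (mem_map (consK _)) IH0 eqSS /sparse /=.
  by case: w => //= b w; rewrite eqSS.
rewrite (mem_map (consK _)) IH1 (_ : (_ \in map _ _) = false).
  by rewrite orbF /sparse eqSS; case: w.
by apply/mapP; case.
Qed.

(** * Simsun conditions and sparse descent words *)

Section Simsun.

Variable m : nat.
Implicit Types (s : 'S_m.+1).

Lemma simsun_sparse s : simsun s -> sparse (descent_word s).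
Proof.
have sw : subword s m.+1 = word s.
  by apply/all_filterP/allP => _ /mapP[i _ ->].
have szw : size (word s) = m.+1 by rewrite size_map size_enum_ord.
have nw i : i < m.+1 -> nth 0 (word s) i = s (inord i).
  move=> im; rewrite (nth_map ord0) ?size_enum_ord //.
  by congr (val (s _)); apply: val_inj; rewrite /= nth_enum_ord // inordK.
move=> /forallP/(_ ord_max); rewrite /no_double_descent /= sw => /forallP dd.
apply/sparseP => i; rewrite size_descent_word => im.
have iw : i < size (word s) by rewrite szw; lia.
have := dd (Ordinal iw); rewrite /double_descent /= szw !nw; try lia.
by rewrite !nth_descent_word /=; lia.
Qed.

(** A double descent in a subword is a decreasing triple whose intermediate point would also survive
    the restriction, between letters that are consecutive there. *)
Lemma sparse_simsun s :
  avoids_both s -> sparse (descent_word s) -> simsun s.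
Proof.
move=> av sp; apply/forallP => k; apply/forallP => -[i iP] /=; apply/negP.
(* [e] lists, in increasing order, the positions of the letters kept in the subword. *)
move: iP => _; pose e := [seq x <- enum 'I_m.+1 | s x < k].
have eE : subword s k = [seq val (s x) | x <- e].
  by rewrite /subword /word filter_map.
rewrite /double_descent eE size_map => /and3P[ie].
have ie1 := ltnW ie; have ie0 := ltnW ie1.
rewrite !(nth_map ord0) //.
set x := nth _ e i; set y := nth _ e _; set z := nth _ e _ => sxy syz.
have e_sorted : sorted (fun x y : 'I_m.+1 => x < y) e.
  apply: sorted_filter; first by move=> ? ? ?; apply: ltn_trans.
  by have := iota_ltn_sorted 0 m.+1; rewrite -val_enum_ord sorted_map.
have eltn i1 i2 : i1 < i2 -> i2 < size e -> nth ord0 e i1 < nth ord0 e i2.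
  move=> i12 i2e; apply: (sorted_ltn_nth _ _ e_sorted) => //.
    by move=> ? ? ?; apply: ltn_trans.
  exact: ltn_trans i12 i2e.
have eleq i1 i2 : i1 < size e -> i2 < size e ->
    nth ord0 e i1 < nth ord0 e i2 -> i1 < i2.
  move=> i1e i2e lt12; rewrite ltnNge; apply/negP.
  by rewrite leq_eqVlt => /predU1P[e21|/eltn]; [rewrite e21 in lt12|]; lia.
have xy : x < y by apply: eltn; lia.
have yz : y < z by apply: eltn; lia.
have xk : s x < k.
  have : x \in e by apply: mem_nth.
  by rewrite mem_filter => /andP[].
have [t [ty /andP[xt tz] /andP[zt tx]]] :=
  sparse_decreasing_triple av sp xy yz sxy syz.
(* Since [s t < s x < k], [t] is in [e]; its index lies strictly between [i] and [i.+2], forcing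
   [t = y]. *)
have te : t \in e by rewrite mem_filter mem_enum (ltn_trans tx xk).
have tie : index t e < size e by rewrite index_mem.
have tE := nth_index ord0 te.
have l1 : i < index t e by apply: eleq; rewrite ?tE //; lia.
have l2 : index t e < i.+2 by apply: eleq; rewrite ?tE //; lia.
move: ty; rewrite -tE /y; have -> : index t e = i.+1 by lia.
by rewrite eqxx.
Qed.

Lemma sparse_descent_wordV s :
  avoids_both s -> sparse (descent_word s) -> sparse (descent_word s^-1%g).
Proof.
move=> av sp; apply/sparseP => i; rewrite size_descent_word => im.
rewrite !nth_descent_word; try lia.
apply/negP => /andP[h1 h2].
(* The triple carries the values [i.+2], [i.+1], [i]; only [i.+1] lies strictly between the
   extremes, so the extra point would be the middle one. *)
have := sparse_decreasing_triple av sp h2 h1.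
rewrite !permKV !inordK; try lia.
move=> []; try lia.
move=> t [/eqP ty _ /andP[zt tx]]; apply: ty.
apply: (canRL (permK s)); apply: val_inj; rewrite /= inordK; lia.
Qed.

Lemma DRSP s :
  reflect (avoids_both s /\ sparse (descent_word s))
          (s \in DRS m.+1 [set p132; p213]).
Proof.
rewrite inE; apply: (iffP and3P) => [[/avoids_bothP av ss _]|[av sp]].
  by split=> //; apply: simsun_sparse.
split; [exact/avoids_bothP|exact: sparse_simsun|].
by apply: sparse_simsun; [exact: avoids_bothV|exact: sparse_descent_wordV].
Qed.

End Simsun.

Theorem theorem3p7 (n : nat) (hn : 1 <= n) :
  #|DRS n [set p132; p213]| = fib n.+1.
Proof.
case: n hn => // m _.
(* Both sides become lengths of duplicate-free lists of words with the same members. *)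
rewrite -size_sparse_words cardE -(size_map (@descent_word m)).
apply/perm_size/uniq_perm; rewrite ?uniq_sparse_words //.
  rewrite map_inj_in_uniq ?enum_uniq // => s t.
  rewrite !mem_enum => /DRSP[avs _] /DRSP[avt _]; exact: descent_word_inj.
move=> w; rewrite mem_sparse_words; apply/mapP/andP => [[s]|[/eqP wm sp]].
  by rewrite mem_enum => /DRSP[_ sp] ->; rewrite size_descent_word.
have [s av sw] := exists_descent_word wm.
by exists s; rewrite // mem_enum; apply/DRSP; rewrite sw.
Qed.
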